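(* Let $(\mathcal V,\otimes,\mathbf 1)$ be a symmetric monoidal category, let $A$ be an algebra object in $\mathcal V$, let $(N,\rho_N)$ be a right $A$-module and $(M,\lambda_M)$ a left $A$-module in $\mathcal V$, and assume that the relative tensor product $q:N\otimes M\to N\otimes_A M$ (the coequalizer of the two action-induced maps $r,\ell:(N\otimes A)\otimes M\rightrightarrows N\otimes M$) exists in $\mathcal V$. Then the functor $$\mathrm{Bal}_A(N,M):\mathcal V\to\mathbf{Set},\qquad X\mapsto\{\varphi:N\otimes M\to X\mid \varphi\text{ is }A\text{-balanced}\}$$ is representable by $N\otimes_A M$. Equivalently, for every $X\in\mathcal V$ there is a bijection, natural in $X$, $$\mathrm{Hom}_{\mathcal V}(N\otimes_A M,X)\;\cong\;\mathrm{Bal}_A(N,M)(X),\qquad \overline\varphi\mapsto \overline\varphi\circ q.$$ Moreover: (i) Every $A$-balanced morphism $\varphi:N\otimes M\to X$ factors uniquely as $\varphi=\overline\varphi\circ q$ with $\overline\varphi:N\otimes_A M\to X$. (ii) Let $\mathsf Q$ be the category whose objects are the epimorphisms $p:N\otimes M\twoheadrightarrow Q$ in $\mathcal V$ such that for every $X\in\mathcal V$ every $A$-balanced morphism $\varphi:N\otimes M\to X$ factors through $p$ (necessarily uniquely, since $p$ is epi), and in which a morphism from $p:N\otimes M\twoheadrightarrow Q$ to $p':N\otimes M\twoheadrightarrow Q'$ is a morphism $u:Q\to Q'$ of $\mathcal V$ with $p'=u\circ p$. Then $q:N\otimes M\twoheadrightarrow N\otimes_A M$ is a terminal object of $\mathsf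 Q$.
   Context: An algebra object in $\mathcal V$ is a monoid object: an object $A$ with an associative, unital multiplication $m:A\otimes A\to A$ and unit $\eta:\mathbf 1\to A$. A right $A$-module is an object $N$ with an action $\rho_N:N\otimes A\to N$, and a left $A$-module is an object $M$ with an action $\lambda_M:A\otimes M\to M$ (satisfying the usual associativity and unit axioms). Let $\alpha_{N,A,M}:(N\otimes A)\otimes M\xrightarrow{\sim}N\otimes(A\otimes M)$ be the associator. Define the two parallel maps $(N\otimes A)\otimes M\to N\otimes M$ by $$r=\rho_N\otimes\mathrm{id}_M,\qquad \ell=(\mathrm{id}_N\otimes\lambda_M)\circ\alpha_{N,A,M}.$$ A morphism $\varphi:N\otimes M\to X$ is called $A$-balanced if $\varphi\circ r=\varphi\circ\ell$. The relative tensor product $N\otimes_A M$, with its canonical map $q:N\otimes M\to N\otimes_A M$, is the coequalizer of the pair $(r,\ell)$. The functor $\mathrm{Bal}_A(N,M)$ acts on morphisms $X\to Y$ by postcomposition. *)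

(* Defs.v *)
(* Equality of morphisms is Leibniz equality; the category of sets is rendered
   as the category of types and functions. *)
From Stdlib Require Import ProofIrrelevance FunctionalExtensionality.

Set Implicit Arguments.
Unset Strict Implicit.
Unset Printing Implicit Defensive.

Declare Scope cat_scope.
Delimit Scope cat_scope with cat.
Local Open Scope cat_scope.

(** * Categories, functors, natural transformations *)

Record Category := {
  Ob :> Type;
  Hom : Ob -> Ob -> Type;
  idm : forall X, Hom X X;
  comp : forall X Y Z, Hom Y Z -> Hom X Y -> Hom X Z;
  comp_assoc : forall W X Y Z (h : Hom Y Z) (g : Hom X Y) (f : Hom W X),
    comp h (comp g f) = comp (comp h g) f;
  comp_idl : forall X Y (f : Hom X Y), comp (idm Y) f = f;
  comp_idr : forall X Y (f : Hom X Y), comp f (idm X) = f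
}.

Arguments Hom {_} _ _.
Arguments idm {_} _.
Arguments comp {_} {X Y Z} _ _.

Notation "g ∘ f" := (comp g f) (at level 40, left associativity) : cat_scope.

Definition is_iso (C : Category) (X Y : C) (f : Hom X Y) : Prop :=
  exists g : Hom Y X, g ∘ f = idm X /\ f ∘ g = idm Y.

Definition is_epi (C : Category) (X Y : C) (p : Hom X Y) : Prop :=
  forall (Z : C) (u v : Hom Y Z), u ∘ p = v ∘ p -> u = v.

Definition is_terminal (C : Category) (T : C) : Prop :=
  forall X : C, exists! f : Hom X T, True.

Definition is_coequalizer (C : Category) (X Y E : C) (f g : Hom X Y)
    (q : Hom Y E) : Prop :=
  q ∘ f = q ∘ g /\
  forall (Z : C) (h : Hom Y Z), h ∘ f = h ∘ g ->
    exists! u : Hom E Z, h = u ∘ q.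

Record Functor (C D : Category) := {
  fob :> C -> D;
  fmap : forall X Y : C, Hom X Y -> Hom (fob X) (fob Y);
  fmap_id : forall X : C, fmap (idm X) = idm (fob X);
  fmap_comp : forall (X Y Z : C) (g : Hom Y Z) (f : Hom X Y),
    fmap (g ∘ f) = fmap g ∘ fmap f
}.

Arguments fmap {C D} _ {X Y} _.

Record NatTrans (C D : Category) (F G : Functor C D) := {
  ntc :> forall X : C, Hom (F X) (G X);
  nt_natural : forall (X Y : C) (f : Hom X Y),
    ntc Y ∘ fmap F f = fmap G f ∘ ntc X
}.

Definition is_nat_iso (C D : Category) (F G : Functor C D)
    (theta : NatTrans F G) : Prop :=
  forall X : C, is_iso (theta X).

Definition SetCat : Category.
Proof.
  refine {| Ob := Type;
            Hom := fun S T => S -> T;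
            idm := fun _ x => x;
            comp := fun _ _ _ g f x => g (f x) |}; reflexivity.
Defined.

Definition HomFunctor (C : Category) (T : C) : Functor C SetCat.
Proof.
  refine {| fob := fun X : C => Hom T X : SetCat;
            fmap := fun X Y (f : Hom X Y) => (fun h : Hom T X => f ∘ h) |}.
  - intros X; apply functional_extensionality; intros h; apply comp_idl.
  - intros X Y Z g f; apply functional_extensionality; intros h; symmetry;
      apply comp_assoc.
Defined.

Definition represented_by (C : Category) (F : Functor C SetCat) (T : C) : Prop :=
  exists theta : NatTrans (HomFunctor T) F, is_nat_iso theta.

(** * Symmetric monoidal categories *)

Reserved Notation "X ⊗ Y" (at level 38, left associativity).
Reserved Notation "f ⊗m g" (at level 38, left associativity).

Record SymMonCategory := {
  smc :> Category;
  tens : smc -> smc -> smc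
    where "X ⊗ Y" := (tens X Y);
  tensm : forall X X' Y Y' : smc, Hom X X' -> Hom Y Y' -> Hom (X ⊗ Y) (X' ⊗ Y')
    where "f ⊗m g" := (tensm f g);
  tensm_id : forall X Y : smc, idm X ⊗m idm Y = idm (X ⊗ Y);
  tensm_comp : forall (X X' X'' Y Y' Y'' : smc)
      (f' : Hom X' X'') (f : Hom X X') (g' : Hom Y' Y'') (g : Hom Y Y'),
    (f' ∘ f) ⊗m (g' ∘ g) = (f' ⊗m g') ∘ (f ⊗m g);
  unit1 : smc;
  assoc : forall X Y Z : smc, Hom ((X ⊗ Y) ⊗ Z) (X ⊗ (Y ⊗ Z));
  lunit : forall X : smc, Hom (unit1 ⊗ X) X;
  runit : forall X : smc, Hom (X ⊗ unit1) X;
  assoc_iso : forall X Y Z : smc, is_iso (assoc X Y Z);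
  lunit_iso : forall X : smc, is_iso (lunit X);
  runit_iso : forall X : smc, is_iso (runit X);
  assoc_natural : forall (X X' Y Y' Z Z' : smc)
      (f : Hom X X') (g : Hom Y Y') (h : Hom Z Z'),
    assoc X' Y' Z' ∘ ((f ⊗m g) ⊗m h) = (f ⊗m (g ⊗m h)) ∘ assoc X Y Z;
  lunit_natural : forall (X Y : smc) (f : Hom X Y),
    lunit Y ∘ (idm unit1 ⊗m f) = f ∘ lunit X;
  runit_natural : forall (X Y : smc) (f : Hom X Y),
    runit Y ∘ (f ⊗m idm unit1) = f ∘ runit X;
  pentagon : forall W X Y Z : smc,
    assoc W X (Y ⊗ Z) ∘ assoc (W ⊗ X) Y Z =
    (idm W ⊗m assoc X Y Z) ∘ assoc W (X ⊗ Y) Z ∘ (assoc W X Y ⊗m idm Z);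
  triangle : forall X Y : smc,
    (idm X ⊗m lunit Y) ∘ assoc X unit1 Y = runit X ⊗m idm Y;
  braid : forall X Y : smc, Hom (X ⊗ Y) (Y ⊗ X);
  braid_natural : forall (X X' Y Y' : smc) (f : Hom X X') (g : Hom Y Y'),
    braid X' Y' ∘ (f ⊗m g) = (g ⊗m f) ∘ braid X Y;
  braid_symmetric : forall X Y : smc, braid Y X ∘ braid X Y = idm (X ⊗ Y);
  hexagon : forall X Y Z : smc,
    assoc Y Z X ∘ braid X (Y ⊗ Z) ∘ assoc X Y Z =
    (idm Y ⊗m braid X Z) ∘ assoc Y X Z ∘ (braid X Y ⊗m idm Z)
}.

Arguments unit1 {_}.
Arguments assoc {_} _ _ _.
Arguments lunit {_} _.
Arguments runit {_} _.
Arguments braid {_} _ _.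

Notation "X ⊗ Y" := (tens X Y) : cat_scope.
Notation "f ⊗m g" := (tensm f g) : cat_scope.

(** * Algebras, modules, balanced morphisms *)

Record Algebra (V : SymMonCategory) := {
  alg_ob :> V;
  alg_mul : Hom (alg_ob ⊗ alg_ob) alg_ob;
  alg_unit : Hom unit1 alg_ob;
  alg_mulA : alg_mul ∘ (alg_mul ⊗m idm alg_ob) =
             alg_mul ∘ (idm alg_ob ⊗m alg_mul) ∘ assoc alg_ob alg_ob alg_ob;
  alg_mul1l : alg_mul ∘ (alg_unit ⊗m idm alg_ob) = lunit alg_ob;
  alg_mul1r : alg_mul ∘ (idm alg_ob ⊗m alg_unit) = runit alg_ob
}.

Arguments alg_mul {V} _.
Arguments alg_unit {V} _.

Record RightModule (V : SymMonCategory) (A : Algebra V) := {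
  rmod_ob :> V;
  ract : Hom (rmod_ob ⊗ A) rmod_ob;
  ract_mul : ract ∘ (ract ⊗m idm (A : V)) =
             ract ∘ (idm rmod_ob ⊗m alg_mul A) ∘ assoc rmod_ob A A;
  ract_unit : ract ∘ (idm rmod_ob ⊗m alg_unit A) = runit rmod_ob
}.

Record LeftModule (V : SymMonCategory) (A : Algebra V) := {
  lmod_ob :> V;
  lact : Hom (A ⊗ lmod_ob) lmod_ob;
  lact_mul : lact ∘ (alg_mul A ⊗m idm lmod_ob) =
             lact ∘ (idm (A : V) ⊗m lact) ∘ assoc (A : V) A lmod_ob;
  lact_unit : lact ∘ (alg_unit A ⊗m idm lmod_ob) = lunit lmod_ob
}.

Arguments ract {V A} _.
Arguments lact {V A} _.

Definition act_r (V : SymMonCategory) (A : Algebra V) (N : RightModule A)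
    (M : LeftModule A) : Hom ((N ⊗ A) ⊗ M) (N ⊗ M) :=
  ract N ⊗m idm (M : V).

Definition act_l (V : SymMonCategory) (A : Algebra V) (N : RightModule A)
    (M : LeftModule A) : Hom ((N ⊗ A) ⊗ M) (N ⊗ M) :=
  (idm (N : V) ⊗m lact M) ∘ assoc (N : V) A M.

Definition balanced (V : SymMonCategory) (A : Algebra V) (N : RightModule A)
    (M : LeftModule A) (X : V) (phi : Hom (N ⊗ M) X) : Prop :=
  phi ∘ act_r N M = phi ∘ act_l N M.

Definition is_relative_tensor (V : SymMonCategory) (A : Algebra V)
    (N : RightModule A) (M : LeftModule A) (T : V) (q : Hom (N ⊗ M) T) : Prop :=
  is_coequalizer (act_r N M) (act_l N M) q.

Lemma sig_ext (S : Type) (P : S -> Prop) (x y : {s | P s}) :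
  proj1_sig x = proj1_sig y -> x = y.
Proof.
  destruct x as [x px], y as [y py]; simpl; intros e; subst y.
  f_equal; apply proof_irrelevance.
Qed.

Lemma balanced_comp (V : SymMonCategory) (A : Algebra V) (N : RightModule A)
    (M : LeftModule A) (X Y : V) (f : Hom X Y) (phi : Hom (N ⊗ M) X) :
  balanced phi -> balanced (f ∘ phi).
Proof.
  unfold balanced; intros e; now rewrite <- !comp_assoc, e.
Qed.

Definition Bal (V : SymMonCategory) (A : Algebra V) (N : RightModule A)
    (M : LeftModule A) : Functor V SetCat.
Proof.
  refine {| fob := fun X : V => {phi : Hom (N ⊗ M) X | balanced phi} : SetCat;
            fmap := fun X Y (f : Hom X Y) =>
              fun phi : {phi : Hom (N ⊗ M) X | balanced phi} =>
                exist (@balanced V A N M Y) (f ∘ proj1_sig phi)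
                  (balanced_comp f (proj2_sig phi)) |}.
  - intros X; apply functional_extensionality; intros phi; apply sig_ext;
      apply comp_idl.
  - intros X Y Z g f; apply functional_extensionality; intros phi;
      apply sig_ext; symmetry; apply comp_assoc.
Defined.

(** * The category of epimorphisms through which all balanced morphisms factor *)

Definition balanced_factor (V : SymMonCategory) (A : Algebra V)
    (N : RightModule A) (M : LeftModule A) (Q : V) (p : Hom (N ⊗ M) Q) : Prop :=
  forall (X : V) (phi : Hom (N ⊗ M) X), balanced phi ->
    exists u : Hom Q X, phi = u ∘ p.

(* Objects p need not be balanced themselves. *)
Record QOb (V : SymMonCategory) (A : Algebra V) (N : RightModule A)
    (M : LeftModule A) := {
  q_ob : V;
  q_map : Hom (N ⊗ M) q_ob;
  q_epi : is_epi q_map;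
  q_factor : balanced_factor q_map
}.

Definition QHom (V : SymMonCategory) (A : Algebra V) (N : RightModule A)
    (M : LeftModule A) (P P' : QOb N M) : Type :=
  {u : Hom (q_ob P) (q_ob P') | q_map P' = u ∘ q_map P}.

Definition QCat (V : SymMonCategory) (A : Algebra V) (N : RightModule A)
    (M : LeftModule A) : Category.
Proof.
  unshelve refine {|
    Ob := QOb N M;
    Hom := @QHom V A N M;
    idm := fun P => exist _ (idm (q_ob P)) _;
    comp := fun P P' P'' v u => exist _ (proj1_sig v ∘ proj1_sig u) _ |}.
  - simpl; symmetry; apply comp_idl.
  - simpl; now rewrite <- comp_assoc, <- (proj2_sig u), <- (proj2_sig v).
  - intros; apply sig_ext, comp_assoc.
  - intros; apply sig_ext, comp_idl.
  - intros; apply sig_ext, comp_idr.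
Defined.

(* Main.v *)
(** Both claims are the universal property of the coequalizer.  Postcomposition
    with [q] maps [Hom T X] onto the balanced morphisms because these are
    exactly the morphisms coequalizing [r] and [l].  For terminality, [q] is
    itself balanced, hence factors through every object of [QCat]; such a factor
    is unique because it is taken through an epimorphism. *)
From Stdlib Require Import FunctionalExtensionality IndefiniteDescription.
Require Import Defs.

Set Implicit Arguments.
Unset Strict Implicit.
Unset Printing Implicit Defensive.

Local Open Scope cat_scope.

(** If [u ∘ q = v ∘ q], then [u] and [v] both factor this one coequalizing morphism through [q], so
    uniqueness identifies them. *)
Lemma coequalizer_epi (C : Category) (X Y E : C) (f g : Hom X Y)
    (q : Hom Y E) : is_coequalizer f g q -> is_epi q.
Proof.
  intros [qfg q_univ] Z u v uv.
  destruct (q_univ Z (u ∘ q)) as [w [_ w_uniq]].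
  - now rewrite <- !comp_assoc, qfg.
  - now rewrite <- (w_uniq u eq_refl); apply w_uniq.
Qed.

Lemma bijective_is_iso (S S' : SetCat) (f : Hom S S') :
  (forall x x' : S, f x = f x' -> x = x') ->
  (forall y : S', exists x : S, f x = y) -> is_iso f.
Proof.
  intros f_inj f_surj.
  (* Surjectivity gives only propositional existence; choice turns it into an inverse function. *)
  destruct (functional_choice (fun y x => f x = y) f_surj) as [g fg].
  exists g; split; apply functional_extensionality; intros x; simpl.
  - apply f_inj, fg.
  - apply fg.
Qed.

(** The transformation that Yoneda assigns to the element [q] of [Bal N M T]. *)
Definition precomp_balanced (V : SymMonCategory) (A : Algebra V)
    (N : RightModule A) (M : LeftModule A) (T : V) (q : Hom (N ⊗ M) T)
    (q_bal : balanced q) : NatTrans (HomFunctor T) (Bal N M).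
Proof.
  refine {| ntc := fun X : V => (fun u : Hom T X =>
              exist (@balanced V A N M X) (u ∘ q) (balanced_comp u q_bal))
              : Hom (HomFunctor T X) (Bal N M X) |}.
  intros X Y f; apply functional_extensionality; intros u.
  apply sig_ext; symmetry; apply comp_assoc.
Defined.

(** Componentwise, [is_epi q] is injectivity and [balanced_factor q] is surjectivity. *)
Lemma precomp_balanced_iso (V : SymMonCategory) (A : Algebra V)
    (N : RightModule A) (M : LeftModule A) (T : V) (q : Hom (N ⊗ M) T)
    (q_bal : balanced q) :
  is_epi q -> balanced_factor q -> is_nat_iso (precomp_balanced q_bal).
Proof.
  intros q_epi q_fact X; apply bijective_is_iso.
  - intros u v uv; apply q_epi, (f_equal (@proj1_sig _ _) uv).
  - intros [phi phi_bal]; destruct (q_fact X phi phi_bal) as [u phiE].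
    exists u; apply sig_ext; now symmetry.
Qed.

Lemma balanced_terminal (V : SymMonCategory) (A : Algebra V)
    (N : RightModule A) (M : LeftModule A) (P : QOb N M) :
  balanced (q_map P) -> is_terminal (C := QCat N M) P.
Proof.
  intros P_bal P'.
  (* The factorization property of [P'], not of [P], is applied, so the morphism goes into [P]. *)
  destruct (q_factor P' P_bal) as [u uE].
  exists (exist _ u uE); split; [exact I|].
  intros [v vE] _; apply sig_ext; simpl.
  apply (q_epi (q := P')); now rewrite <- uE.
Qed.

Theorem theorem5p1 (V : SymMonCategory) (A : Algebra V) (N : RightModule A)
    (M : LeftModule A) (T : V) (q : Hom (N ⊗ M) T)
    (hq : is_relative_tensor q) :
  represented_by (Bal N M) T /\
  (exists theta : NatTrans (HomFunctor T) (Bal N M),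
     is_nat_iso theta /\
     forall (X : V) (phibar : Hom T X),
       proj1_sig (theta X phibar) = phibar ∘ q) /\
  (forall (X : V) (phi : Hom (N ⊗ M) X), balanced phi ->
     exists! phibar : Hom T X, phi = phibar ∘ q) /\
  (exists (q_is_epi : is_epi q) (q_factors : balanced_factor q),
     is_terminal (C := QCat N M)
       {| q_ob := T; q_map := q; q_epi := q_is_epi; q_factor := q_factors |}).
Proof.
  pose proof (coequalizer_epi hq) as q_epi.
  (* Up to conversion, [q_bal] says that [q] is balanced, and [q_univ] ranges over exactly the
     balanced morphisms. *)
  destruct hq as [q_bal q_univ].
  assert (q_fact : balanced_factor q).
  { intros X phi phi_bal; destruct (q_univ X phi phi_bal) as [u [uE _]].
    now exists u. }
  pose proof (precomp_balanced_iso q_bal q_epi q_fact) as theta_iso.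
  split; [|split; [|split]].
  - now exists (precomp_balanced q_bal).
  - now exists (precomp_balanced q_bal).
  - exact q_univ.
  - exists q_epi, q_fact; now apply balanced_terminal.
Qed.
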